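(* There is an absolute constant $C>0$ such that for any edge-ordered graph $H$ on $n\ge 2$ vertices, $r_{\text{edge, ind}}(H)\le 2^{Cn^2(\log_2 n)^2}$.
   Context: An edge-ordered graph is a finite simple graph (not necessarily complete) together with a total ordering of its edges. Two edge-ordered graphs are equivalent if there is a graph isomorphism between them preserving the ordering of the edges. A monochromatic induced copy of $H$ in an edge-colored edge-ordered graph $G$ is an induced subgraph of $G$ (with inherited edge-ordering) equivalent to $H$ all of whose edges have the same color. The edge-induced Ramsey number $r_{\text{edge, ind}}(H)$ is the smallest $N$ such that there exists an edge-ordered graph $G$ on $N$ vertices such that every two-coloring of the edges of $G$ contains a monochromatic induced copy of $H$. *)

(* Defs.v *)
From mathcomp Require Import all_boot.
Set Implicit Arguments.
Unset Strict Implicit.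
Unset Printing Implicit Defensive.

(* Edges are 2-element vertex sets.  Only the restriction of [edge_le] to the
   edges is meaningful; reflexivity there follows from totality. *)
Record eograph := EOGraph {
  vertex :> finType;
  edges : {set {set vertex}};
  edge_le : rel {set vertex};
  edges_card2 : {in edges, forall e : {set vertex}, #|e| = 2};
  edge_le_anti : {in edges &, antisymmetric edge_le};
  edge_le_trans : {in edges & &, transitive edge_le};
  edge_le_total : {in edges &, total edge_le}
}.

Arguments edges : clear implicits.
Arguments edge_le : clear implicits.

Definition eo_equiv (H G : eograph) : Prop :=
  exists f : H -> G,
    [/\ bijective f,
        forall e : {set H}, (f @: e \in edges G) = (e \in edges H)
      & {in edges H &, forall e1 e2 : {set H},
           edge_le G (f @: e1) (f @: e2) = edge_le H e1 e2}].

Section Induced.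

Variables (G : eograph) (S : {set G}).

Let V : finType := {x : G | x \in S}.

Definition induced_edges : {set {set V}} :=
  [set e : {set V} | (val @: e : {set G}) \in edges G].

Definition induced_le : rel {set V} :=
  fun e1 e2 => edge_le G (val @: e1) (val @: e2).

Lemma induced_card2 : {in induced_edges, forall e : {set V}, #|e| = 2}.
Proof.
move=> e; rewrite inE => /edges_card2.
by rewrite (card_imset _ val_inj).
Qed.

Lemma induced_le_anti : {in induced_edges &, antisymmetric induced_le}.
Proof.
move=> e1 e2; rewrite !inE => h1 h2 h12.
exact: (imset_inj val_inj) (edge_le_anti h1 h2 h12).
Qed.

Lemma induced_le_trans : {in induced_edges & &, transitive induced_le}.
Proof.
by move=> e2 e1 e3; rewrite !inE => h2 h1 h3; apply: edge_le_trans.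
Qed.

Lemma induced_le_total : {in induced_edges &, total induced_le}.
Proof. by move=> e1 e2; rewrite !inE => h1 h2; apply: edge_le_total. Qed.

Definition induced : eograph :=
  EOGraph induced_card2 induced_le_anti induced_le_trans induced_le_total.

End Induced.

(* A colouring is given on all vertex sets, but only its values on edges are
   ever used. *)
Definition mono_induced_copy (H G : eograph) (c : {set G} -> bool)
    (S : {set G}) : Prop :=
  eo_equiv H (induced S) /\
  exists b : bool, {in edges G, forall e : {set G}, e \subset S -> c e = b}.

Definition edge_ind_arrows (H : eograph) (N : nat) : Prop :=
  exists2 G : eograph, #|G| = N &
    forall c : {set G} -> bool, exists S : {set G}, mono_induced_copy H c S.

(* [N] is the edge-induced Ramsey number of [H].  Stated as a relation, so
   that the existence of the minimum has to be asserted wherever it is used. *)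
Definition is_edge_ind_ramsey (H : eograph) (N : nat) : Prop :=
  edge_ind_arrows H N /\ forall M : nat, edge_ind_arrows H M -> N <= M.

(* Main.v *)
Require Import Defs.
From HB Require Import structures.
From mathcomp Require Import all_boot all_order all_algebra.
From mathcomp Require Import finfield zify ring lra boolp.
From mathcomp Require Import reals exp.
Set Implicit Arguments.
Unset Strict Implicit.
Unset Printing Implicit Defensive.
Import Order.TTheory GRing.Theory Num.Theory.

(* Label the pairs of a large vertex set quasirandomly with words of length
   about [n] over an alphabet of about [n ^ 2] letters, let one further label
   mean non-edge, and order the edges of [G] lexicographically by their labels.
   Fix a red/blue colouring and a zone, i.e. the set of words with a given
   prefix.  A greedy search for a blue copy of [H] whose edge of rank [r] is
   labelled in the [r]-th child zone either succeeds or gets stuck at two large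
   sets [A], [B] with very few blue edges between them in one child zone.
   Passing to that child zone and recursing inside [A], then, in the zone found
   there, inside what is left of [B], produces in [log n] rounds, and within a
   single zone, [n] large sets that are pairwise almost free of blue.  That zone
   still has a free letter, so a red copy of [H] can be embedded across these
   sets.  Each round shrinks the sets by a factor [2 ^ O(n ^ 2 log n)]: there
   are [n] greedy steps, each losing a factor polynomial in the number
   [2 ^ O(n log n)] of labels.  Since a zone is only ever refined, the relevant
   letters need not agree along the recursion, which saves a factor [n ^ 2] in
   the number of rounds. *)

Local Open Scope nat_scope.

(** * Greedy embedding *)

Lemma card_le_sum_cover (I : eqType) (T : finType) (A : {set T}) (s : seq I)
    (P : I -> pred T) :
  {in A, forall x, has (P^~ x) s} ->
  #|A| <= \sum_(w <- s) #|[set x in A | P w x]|.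
Proof.
elim: s A => [|w s IH] A cov.
  rewrite big_nil leqn0 cards_eq0; apply/eqP/setP => x; rewrite inE.
  by apply/negP => /cov.
rewrite big_cons -(cardsID [set x | P w x] A) leq_add //.
  by apply: subset_leq_card; apply/subsetP => x; rewrite !inE.
have /IH/leq_trans-> // : {in A :\: [set x | P w x], forall x, has (P^~ x) s}.
  by move=> x; rewrite !inE => /andP[/negPf nPx /cov /=]; rewrite nPx.
apply: leq_sum => v _; apply: subset_leq_card.
by apply/subsetP => x; rewrite !inE -andbA => /and3P[_ -> ->].
Qed.

Lemma pigeonhole_cover (I : eqType) (T : finType) (A : {set T}) (s : seq I)
    (P : I -> pred T) :
  0 < #|A| -> {in A, forall x, has (P^~ x) s} ->
  exists2 w, w \in s & #|A| <= size s * #|[set x in A | P w x]|.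
Proof.
move=> A0 /card_le_sum_cover leA.
have [/hasP[w ws le]|/hasPn small] :=
  boolP (has (fun w => #|A| <= size s * #|[set x in A | P w x]|) s).
  by exists w.
exfalso.
have : size s * #|A| <= size s * #|A|.-1.
  rewrite (leq_trans (leq_mul (leqnn _) leA)) // big_distrr /=.
  rewrite big_seq (leq_trans (n := \sum_(w <- s | w \in s) #|A|.-1)) //.
    by apply: leq_sum => w /small; lia.
  by rewrite -big_seq big_const_seq count_predT iter_addn_0 mulnC.
have : 0 < size s by case: s leA {small} => //=; rewrite big_nil; lia.
nia.
Qed.

(* The second alternative is the step at which the greedy choice gets stuck,
   reported in terms of the candidate sets [A] and [B] current at that time. *)
Lemma greedy_embedding (I : eqType) (T : finType) (x0 : T)
    (R : I -> I -> rel T) (d sigma : nat) (s : seq I) (W : I -> {set T}) :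
  (forall u w x y, R u w x y = R w u y x) ->
  uniq s -> 0 < d -> 0 < sigma ->
  {in s, forall u, sigma * d ^ size s <= #|W u|} ->
  (exists2 f : I -> T, {in s, forall u, f u \in W u} &
     {in s &, forall u w, u != w -> R u w (f u) (f w)}) \/
  exists u w (A B : {set T}),
    [/\ [/\ u \in s, w \in s & u != w], A \subset W u, B \subset W w,
        sigma <= #|A| * size s /\ sigma <= #|B| &
        {in A, forall x, #|[set y in B | R u w x y]| * d < #|B|}].
Proof.
move=> Rsym; elim: s W => [|u s IH] W /=; first by left; exists (fun=> x0).
move=> /andP[us s_uniq] d0 sg0 leW.
pose N w x := [set y in W w | R u w x y].
pose bad w x := #|N w x| * d < #|W w|.
have dpos k : 0 < d ^ k by rewrite expn_gt0 d0.
have sW w : w \in u :: s -> sigma <= #|W w|.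
  by move=> /leW; apply: leq_trans; rewrite leq_pmulr.
have [/existsP[v /andP[vW /hasPn good]]|/existsPn stuck] :=
  boolP [exists v, (v \in W u) && ~~ has (fun w => bad w v) s].
- have /(IH (fun w => N w v) s_uniq d0 sg0) :
      {in s, forall w, sigma * d ^ size s <= #|N w v|}.
    move=> w ws; have := good w ws; rewrite /bad -leqNgt => le1.
    have := leW w; rewrite inE ws orbT => /(_ isT) /leq_trans/(_ le1).
    by rewrite expnSr mulnA leq_pmul2r.
  case=> [[f fN fR]|[u' [w' [A [B [[u's w's uw] AN BN [lA lB] low]]]]]]; last first.
    right; exists u', w', A, B; split => //.
    - by rewrite !inE u's w's !orbT.
    - by apply: subset_trans AN _; apply/subsetP => y; rewrite inE => /andP[].
    - by apply: subset_trans BN _; apply/subsetP => y; rewrite inE => /andP[].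
    - by split=> //; rewrite mulnS; lia.
  left; exists (fun w => if w == u then v else f w) => [w|w1 w2]; rewrite !inE.
    by case: eqP => [->|_] //= /fN; rewrite inE => /andP[].
  case: (eqVneq w1 u) => [->|n1]; case: (eqVneq w2 u) => [->|n2] //=.
  + by move=> _ ws _; have := fN _ ws; rewrite inE => /andP[].
  + by move=> ws _ _; rewrite Rsym; have := fN _ ws; rewrite inE => /andP[].
  + exact: fR.
right.
have cov : {in W u, forall x, has (fun w => bad w x) s}.
  by move=> x xW; have := stuck x; rewrite xW negbK.
have W0 : 0 < #|W u| by apply: leq_trans sg0 (sW u _); rewrite inE eqxx.
(* Each vertex of [W u] fails for some later index; keeping the commonest one costs the factor
   [size s] recorded for [A]. *)
have [w ws le] := pigeonhole_cover W0 cov.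
exists u, w, [set x in W u | bad w x], (W w); split=> //.
- by rewrite !inE eqxx ws orbT; split=> //; apply: contraNneq us => ->.
- by apply/subsetP => y; rewrite inE => /andP[].
- split; last by apply: sW; rewrite inE ws orbT.
  by have := sW u; rewrite inE eqxx => /(_ isT); lia.
- by move=> x; rewrite inE => /andP[].
Qed.

(** * Monochromatic copies in quasirandom labellings *)

Lemma exists_card_between (T : finType) (A B : {set T}) (h : nat) :
  A \subset B -> #|A| <= h <= #|B| ->
  exists Y : {set T}, [/\ A \subset Y, Y \subset B & #|Y| = h].
Proof.
move=> AB /andP[leA leB].
pose Z := [set x in take (h - #|A|) (enum (B :\: A))].
have ZBA : Z \subset B :\: A.
  by apply/subsetP => x; rewrite inE => /mem_take; rewrite mem_enum.
exists (A :|: Z); split; first exact: subsetUl.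
  by rewrite subUset AB (subset_trans ZBA) ?subsetDl.
have := ZBA; rewrite subsetD disjoint_sym => /andP[_ /disjoint_setI0 AZ].
rewrite cardsU AZ cards0 subn0 cardsE.
rewrite (card_uniqP _) ?take_uniq ?enum_uniq //.
have := cardsID A B; rewrite (setIidPr AB) size_take -cardE.
by case: ltnP; lia.
Qed.

(** Source of the 16: a blue neighbourhood keeps at most twice its proportional share [1 / L], its
    host set at least [1 / (8 * L)], so densities grow by at most [2 * 8]. *)
Lemma density_step (f f' h y L c c' : nat) :
  f' <= f -> f * L <= 2 * h -> h * (16 * y) <= c -> c <= c' * (8 * L) ->
  0 < L -> f' * y <= c'.
Proof.
move=> lef leh lec lec' L0; have L16 : 0 < 16 * L by lia.
rewrite -(leq_pmul2r L16); have := leq_mul lef (leqnn (16 * y * L)).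
by have := leq_mul leh (leqnn (16 * y)); lia.
Qed.

(* Labels are read as words over a [K]-letter alphabet: [zone K k a] collects
   the words with a given prefix and [k] free letters, and its children are the
   zones [zone K k.-1 (a + r * K ^ k.-1)] with [r < K]. *)
Definition zone (K k a l : nat) : bool := (a <= l) && (l < a + K ^ k).

Lemma child_zone_le K k a r : r < K -> a + r * K ^ k + K ^ k <= a + K ^ k.+1.
Proof.
by move=> rK; rewrite -addnA leq_add2l addnC -mulSn expnS leq_mul2r rK orbT.
Qed.

Lemma zone_child K k a r l :
  r < K -> zone K k (a + r * K ^ k) l -> zone K k.+1 a l.
Proof.
rewrite /zone => /(child_zone_le k a) le /andP[le1 le2].
by rewrite (leq_trans (leq_addr _ _) le1) (leq_trans le2).
Qed.

Section LabelledArrow.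

Variables (V : finType) (lab : V -> V -> nat) (blue : rel V).
Variables (L S T : nat).
Hypotheses (labC : forall x y, lab x y = lab y x).
Hypotheses (blueC : forall x y, blue x y = blue y x).
Hypotheses (L_gt0 : 0 < L) (S_gt0 : 0 < S).

Definition nbhd (l : nat) (x : V) : {set V} := [set y | lab x y == l].

(** Together with [few_high], this keeps degrees near the expected [#|Y| / L], up to [S / T]
    exceptions on either side; a large [T] leaves room for union bounds over pairs of indices. *)
Hypothesis few_low : forall (Y : {set V}) l, S <= #|Y| -> l < L ->
  #|[set x | #|Y :&: nbhd l x| * (4 * L) < #|Y|]| * T <= S.
Hypothesis few_high : forall (Y : {set V}) l, S <= #|Y| -> l < L ->
  #|[set x | 2 * #|Y| < #|Y :&: nbhd l x| * L]| * T <= S.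

Variables (I : finType) (adj : rel I) (rk : I -> I -> nat) (K : nat).
Hypotheses (adjC : forall u w, adj u w = adj w u).
Hypotheses (rkC : forall u w, rk u w = rk w u).
Hypothesis rk_lt : forall u w, adj u w -> rk u w < K.

Local Notation zone := (zone K).

(* The last label [L.-1] stands for non-adjacency. *)
Definition matches (b : bool) (k a : nat) (u w : I) (x y : V) : bool :=
  if adj u w then zone k (a + rk u w * K ^ k) (lab x y) && (blue x y == b)
  else lab x y == L.-1.

Definition zone_copy (b : bool) (k a : nat) : Prop :=
  exists f : I -> V, forall u w, u != w -> matches b k a u w (f u) (f w).

Definition blue_in (k a : nat) (x : V) : {set V} :=
  [set y | zone k a (lab x y) && blue x y].

Lemma matchesC b k a u w x y : matches b k a u w x y = matches b k a w u y x.
Proof. by rewrite /matches adjC rkC labC blueC. Qed.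

Lemma blue_inC k a x y : (y \in blue_in k a x) = (x \in blue_in k a y).
Proof. by rewrite !inE labC blueC. Qed.

(** The greedy search starts with every candidate set equal to [U]; [r] is the rank of the pair at
    which it gets stuck. *)
Lemma blue_copy_or_sparse_pair (d sigma k a : nat) (U : {set V}) :
  4 * L <= d -> #|I| < T -> S <= sigma -> sigma * d ^ #|I| <= #|U| ->
  ~ zone_copy true k a ->
  exists r (A B : {set V}),
    [/\ r < K, A \subset U, B \subset U,
        sigma <= #|A| * #|I| /\ sigma <= #|B| &
        {in A, forall x, #|B :&: blue_in k (a + r * K ^ k) x| * d < #|B|}].
Proof.
move=> leLd ltT leS leU nocopy.
have sg0 : 0 < sigma by apply: leq_trans leS.
have [U0|[x0 x0U]] := set_0Vmem U.
  have : 0 < d ^ #|I| by rewrite expn_gt0; lia.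
  by exfalso; move: leU; rewrite U0 cards0; nia.
have d0 : 0 < d by lia.
have := greedy_embedding x0 (R := matches true k a) (d := d) (sigma := sigma)
  (s := enum I) (W := fun=> U) (matchesC true k a) (enum_uniq I) d0 sg0.
rewrite -cardE => /(_ (fun _ _ => leU)).
case=> [[f _ fR]|[u [w [A [B [[_ _ uw] AU BU [lA lB] low]]]]]].
  by case: nocopy; exists f => u w; apply: fR; rewrite mem_enum.
have [uwadj|uwN] := boolP (adj u w).
  exists (rk u w), A, B; split=> //; first exact: rk_lt.
  move=> x /low; rewrite /matches uwadj; congr (_ * _ < _).
  by apply: eq_card => y; rewrite !inE eqb_id.
(* At a non-adjacent pair all of [A] would be exceptional for the label [L.-1], so [#|A| * T <= S],
   against [S <= #|A| * #|I|] and [#|I| < T]. *)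
have := @few_low B L.-1 (leq_trans leS lB); rewrite prednK // leqnn => /(_ isT).
have /subset_leq_card : A \subset
    [set x | #|B :&: nbhd L.-1 x| * (4 * L) < #|B|].
  apply/subsetP => x /low; rewrite /matches (negPf uwN) inE => lt.
  apply: leq_ltn_trans lt; rewrite leq_mul //.
  by apply: subset_leq_card; apply/subsetP => y; rewrite !inE.
move=> leA leT; exfalso; have A0 : 0 < #|A|.
  by case: posnP lA => // ->; rewrite mul0n leqNgt sg0.
have lt : #|A| * #|I| < #|A| * T by rewrite ltn_pmul2l.
have := leq_trans lt (leq_trans (leq_mul leA (leqnn T)) leT).
by rewrite ltnNge (leq_trans leS lA).
Qed.

(** * Large sets that are pairwise sparse in blue *)

Definition sparse_to (k a d : nat) : rel {set V} :=
  fun X Y => [forall x in X, #|Y :&: blue_in k a x| * d <= #|Y|].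

Lemma sparse_toP k a d (X Y : {set V}) :
  reflect {in X, forall x, #|Y :&: blue_in k a x| * d <= #|Y|}
          (sparse_to k a d X Y).
Proof. exact: 'forall_in_idP. Qed.

Lemma sub_sparse_to k a k' a' d X Y :
  a <= a' -> a' + K ^ k' <= a + K ^ k ->
  sparse_to k a d X Y -> sparse_to k' a' d X Y.
Proof.
move=> le1 le2 /sparse_toP sp; apply/sparse_toP => x /sp; apply: leq_trans.
rewrite leq_mul2r; apply/orP; right; apply: subset_leq_card.
apply/subsetP => y; rewrite !inE => /andP[-> /andP[+ ->]] /=.
by rewrite /zone andbT; lia.
Qed.

Lemma sum_card_blue_in k a (X Y : {set V}) :
  \sum_(x in X) #|Y :&: blue_in k a x| = \sum_(y in Y) #|X :&: blue_in k a y|.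
Proof.
have card_sum (A B : {set V}) : #|A :&: B| = \sum_(y in A) (y \in B).
  rewrite -sum1_card big_mkcond [RHS]big_mkcond /=; apply: eq_bigr => y _.
  by rewrite inE; case: (y \in A); case: (y \in B).
under eq_bigr do rewrite card_sum.
rewrite exchange_big /=; apply: eq_bigr => y _; rewrite card_sum.
by apply: eq_bigr => x _; rewrite blue_inC.
Qed.

(* Double counting of the blue pairs between [X] and [B]. *)
Lemma card_dense_to k a d c (X B : {set V}) :
  {in X, forall x, #|B :&: blue_in k a x| * (d * c) <= #|B|} -> 0 < #|X| ->
  #|[set y in B | #|X| < #|X :&: blue_in k a y| * d]| * c <= #|B|.
Proof.
move=> sp X0; set D := [set _ in _ | _].
have le1 : \sum_(x in X) #|B :&: blue_in k a x| * (d * c) <= #|X| * #|B|.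
  by rewrite -sum_nat_const leq_sum.
have le2 : #|D| * #|X| <= \sum_(y in B) #|X :&: blue_in k a y| * d.
  rewrite -sum_nat_const (bigID (mem D) (mem B)) /=.
  apply: leq_trans (leq_addr _ _).
  rewrite [leqRHS](eq_bigl (mem D)) => [|y]; last by rewrite !inE; lia.
  by apply: leq_sum => y; rewrite inE => /andP[_ /ltnW].
move: le1; rewrite -big_distrl /= sum_card_blue_in.
move: le2; rewrite -big_distrl /= => le2 le1.
by rewrite -(leq_pmul2l X0); nia.
Qed.

(** Each round doubles the number of sets: one half is found inside [A], the other inside the part
    of [B] not dense to any of the first. The letters consumed satisfy
    [1 + 2 * (2 ^ j - 1) = 2 ^ j.+1 - 1]. *)
Lemma sparse_sequence (d d' sigma h j : nat) :
  4 * L <= d -> #|I| < T -> S <= sigma -> 0 < #|I| ->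
  2 * d' * 2 ^ j <= d -> 2 * #|I| * d ^ #|I| <= h ->
  (forall k a, a + K ^ k.+1 < L -> ~ zone_copy true k a) ->
  forall (U : {set V}) k a, 2 ^ j <= k -> a + K ^ k < L -> sigma * h ^ j <= #|U| ->
  exists k' a' (Ws : seq {set V}),
    [/\ k <= k' + 2 ^ j - 1, a <= a' /\ a' + K ^ k' <= a + K ^ k,
        size Ws = 2 ^ j,
        all (fun W : {set V} => (W \subset U) && (sigma <= #|W|)) Ws &
        pairwise (sparse_to k' a' d') Ws].
Proof.
move=> led ltT leS I0 + leh nocopy.
elim: j => [|j IH] led' U k a lek lea leU.
  by exists k, a, [:: U]; rewrite /= subxx expn0 muln1 in leU *; split=> //; lia.
have {}IH := IH (leq_trans _ led').
have /IH {}IH : 2 * d' * 2 ^ j <= 2 * d' * 2 ^ j.+1.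
  by rewrite leq_mul2l leq_exp2l // leqnSn orbT.
have j0 : 0 < 2 ^ j by rewrite expn_gt0.
case: k lek lea => [|k lek lea]; first by rewrite expnS; lia.
have d0 : 0 < d by lia.
have dI0 : 0 < d ^ #|I| by rewrite expn_gt0 d0.
have hj0 : 0 < h ^ j by rewrite expn_gt0; nia.
(* The factor [#|I|] pays for the loss in [A], the factor 2 for the pruning of [B]. *)
have [] := @blue_copy_or_sparse_pair d (2 * #|I| * (sigma * h ^ j)) k a U led ltT.
- by rewrite (leq_trans leS) // mulnCA leq_pmulr // !muln_gt0 I0 hj0.
- apply: leq_trans leU; rewrite expnS.
  have := leq_mul (leqnn (sigma * h ^ j)) leh.
  by move: (d ^ #|I|) (h ^ j) => p q; lia.
- exact: nocopy.
move=> r [A [B [rK AU BU [lA lB] low]]].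
have leaL : a + r * K ^ k + K ^ k < L.
  by apply: leq_ltn_trans lea; apply: child_zone_le.
have [|||k1 [a1 [Xs [lek1 [lea1 lea1'] sXs /allP AXs pXs]]]] :=
  IH A k (a + r * K ^ k).
- by move: lek; rewrite expnS; lia.
- exact: leaL.
- by nia.
have c0 : 0 < 2 ^ j.+1 by rewrite expn_gt0.
have lowX (X : {set V}) : X \in Xs ->
    {in X, forall x, #|B :&: blue_in k1 a1 x| * (d' * 2 ^ j.+1) <= #|B|}.
  move=> /AXs/andP[/subsetP XA _] x /XA xA.
  have sub : #|B :&: blue_in k1 a1 x| <= #|B :&: blue_in k (a + r * K ^ k) x|.
    apply: subset_leq_card.
    apply/subsetP => y; rewrite !inE => /andP[-> /andP[+ ->]] /=.
    by rewrite /zone andbT; lia.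
  apply: leq_trans (ltnW (low x xA)).
  by apply: leq_mul => //; lia.
pose dense (X : {set V}) := [set y in B | #|X| < #|X :&: blue_in k1 a1 y| * d'].
pose B' := [set y in B | all (fun X : {set V} => y \notin dense X) Xs].
(* Each of the [2 ^ j] sets in [Xs] excludes at most a fraction [1 / 2 ^ j.+1] of [B]. *)
have leB' : #|B| <= 2 * #|B'|.
  have le1 : #|B :\: B'| <= \sum_(X <- Xs) #|dense X|.
    have cov : {in B :\: B', forall y, has (fun X : {set V} => y \in dense X) Xs}.
      move=> y; rewrite 2!inE => /andP[+ yB]; rewrite yB /= -has_predC.
      by move=> /hasP[X XXs /=]; rewrite negbK => yX; apply/hasP; exists X.
    apply: leq_trans (card_le_sum_cover (P := fun X y => y \in dense X) cov) _.
    apply: leq_sum => X _.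
    by apply: subset_leq_card; apply/subsetP => y; rewrite !inE => /andP[_].
  have le2 : (\sum_(X <- Xs) #|dense X|) * 2 ^ j.+1 <= size Xs * #|B|.
    rewrite big_distrl /= big_seq.
    apply: (@leq_trans (\sum_(X <- Xs | X \in Xs) #|B|)).
      apply: leq_sum => X XXs; apply: card_dense_to; first exact: lowX.
      by case/andP: (AXs X XXs) => _; lia.
    by rewrite -big_seq big_const_seq count_predT iter_addn_0 mulnC.
  have := cardsID B' B; rewrite (setIidPr _); last first.
    by apply/subsetP => y; rewrite inE => /andP[].
  have le3 : 2 * (\sum_(X <- Xs) #|dense X|) <= #|B|.
    by rewrite -(leq_pmul2l j0); move: le2; rewrite sXs expnS; lia.
  by lia.
have [|||k2 [a2 [Ys [lek2 [lea2 lea2'] sYs AYs pYs]]]] := IH B' k1 a1.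
- by move: lek; rewrite expnS; lia.
- by lia.
- by nia.
(* [Ys] comes first: sparsity is required only from earlier to later sets, and [B'] was pruned to be
   sparse towards [Xs]. *)
exists k2, a2, (Ys ++ Xs); split.
- by rewrite expnS; lia.
- by have := child_zone_le k a rK; lia.
- by rewrite size_cat sYs sXs expnS; lia.
- rewrite all_cat; apply/andP; split.
    apply: sub_all AYs => Y /andP[YB' ->]; rewrite andbT.
    apply: subset_trans YB' (subset_trans _ BU).
    by apply/subsetP => y; rewrite inE => /andP[].
  by apply/allP => X /AXs /andP[XA ->]; rewrite andbT (subset_trans XA).
- rewrite pairwise_cat pYs; apply/and3P; split=> //; last first.
    by apply: sub_pairwise pXs => X Y; apply: sub_sparse_to.
  apply/allrelP => Y X YYs XXs; apply: (sub_sparse_to lea2 lea2').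
  apply/sparse_toP => y yY.
  have /subsetP/(_ y yY) := proj1 (andP (allP AYs Y YYs)).
  rewrite inE => /andP[yB /allP/(_ X XXs)]; rewrite inE yB /= -leqNgt.
  exact.
Qed.

(** * Red embedding across sparse sets *)

Definition target (k a : nat) (u w : I) : nat :=
  if adj u w then a + rk u w * K ^ k else L.-1.

Lemma targetC k a u w : target k a u w = target k a w u.
Proof. by rewrite /target adjC rkC. Qed.

Lemma target_lt k a u w : a + K ^ k.+1 < L -> target k a u w < L.
Proof.
move=> leL; rewrite /target; case: ifP => [/rk_lt rK|_]; last by lia.
by have := child_zone_le k a rK; lia.
Qed.

(** In use [h] bounds the blue degrees from [X] into [Y], so [2 * h / L] is twice the share expected
    in one label class of [v]. *)
Definition crowded (k a l h : nat) (X Y : {set V}) (v : V) : {set V} :=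
  [set y in X | 2 * h < #|Y :&: nbhd l v :&: blue_in k a y| * L].

(** By [few_high], applied to the blue neighbourhood padded to size [h], each [y] is crowded for at
    most [S / T] vertices [v]; double counting and Markov's inequality conclude. *)
Lemma card_many_crowded (k a x l n : nat) (X Y : {set V}) :
  l < L -> S * x <= #|Y| -> 0 < x -> 0 < #|X| -> sparse_to k a x X Y ->
  #|[set v | #|X| < #|crowded k a l (#|Y| %/ x) X Y v| * n]| * T <= n * S.
Proof.
move=> lL leY x0 X0 /sparse_toP sp.
set h := _ %/ _; have hS : S <= h by rewrite leq_divRL.
pose D v := crowded k a l h X Y v; rewrite -/D.
have few y : y \in X -> #|[set v | y \in D v]| * T <= S.
  move=> yX; have /(exists_card_between (subsetIl _ _))[Z [FZ ZY cZ]] :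
      #|Y :&: blue_in k a y| <= h <= #|Y|.
    by rewrite leq_divRL // sp //= leq_div.
  apply: leq_trans (few_high (l := l) (Y := Z) _ lL); last by rewrite cZ.
  rewrite leq_mul2r; apply/orP; right; apply: subset_leq_card.
  apply/subsetP => v; rewrite !inE cZ yX /= => lt; apply: leq_trans lt _.
  rewrite leq_mul2r; apply/orP; right; apply: subset_leq_card.
  apply/subsetP => z; rewrite !inE => /andP[/andP[zY zv] zF].
  by rewrite zv andbT (subsetP FZ) // !inE zY.
rewrite -(leq_pmul2r X0) -mulnA [T * _]mulnC mulnA.
set B := [set v | _].
have le1 : #|B| * #|X| <= \sum_v #|D v| * n.
  rewrite -sum_nat_const (bigID (mem B) predT) /=.
  apply: leq_trans (leq_addr _ _); apply: leq_sum => v.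
  by rewrite inE => /ltnW.
have le2 : (\sum_v #|D v|) * T <= #|X| * S.
  have -> : \sum_v #|D v| = \sum_(y in X) #|[set v | y \in D v]|.
    under eq_bigr do rewrite -sum1_card big_mkcond.
    rewrite exchange_big /= [RHS]big_mkcond /=; apply: eq_bigr => y _.
    case: ifPn => yX.
      by rewrite -big_mkcond sum1dep_card.
    by apply: big1 => v _; rewrite !inE (negPf yX).
  by rewrite big_distrl /= -sum_nat_const leq_sum.
apply: leq_trans (leq_mul le1 (leqnn T)) _.
by rewrite -big_distrl /= mulnAC mulnC -mulnA leq_mul2l [S * _]mulnC le2 orbT.
Qed.

(* At each step a vertex [v] is chosen so that restricting the later sets to its
   neighbourhoods of the right labels does not concentrate the blue pairs: each
   set keeps a fraction [1 / (8 * L)], and the density of blue between two of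
   them grows by a factor of at most 16. *)
Lemma sparse_embedding (k a E : nat) (s : seq I) (W : I -> {set V}) :
  16 * L * #|I| ^ 3 < T -> 16 * L <= E -> a + K ^ k.+1 < L -> uniq s ->
  0 < #|V| ->
  {in s, forall u, S * (E * 16 ^ size s) * (8 * L) ^ size s <= #|W u|} ->
  pairwise (fun u w => sparse_to k.+1 a (E * 16 ^ size s) (W u) (W w)) s ->
  exists2 f : I -> V, {in s, forall u, f u \in W u} &
    {in s &, forall u w, u != w -> lab (f u) (f w) = target k a u w /\
       f w \notin blue_in k.+1 a (f u)}.
Proof.
move=> leT leE leL + /card_gt0P[x0 _].
elim: s W => [|u s IH] W /=; first by exists (fun=> x0).
move=> /andP[us s_uniq] leW /andP[spu sps].
pose y := E * 16 ^ size s; pose x := E * 16 ^ (size s).+1.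
have E0 : 0 < E by lia.
have y0 : 0 < y by rewrite muln_gt0 E0 expn_gt0.
have xy : x = 16 * y by rewrite /x /y expnS mulnCA.
have leWS w : w \in u :: s -> S * x <= #|W w|.
  by move=> /leW; apply: leq_trans; rewrite leq_pmulr // expn_gt0; lia.
have W0 w : w \in u :: s -> 0 < #|W w|.
  by move=> /leWS; apply: leq_trans; rewrite muln_gt0 S_gt0; lia.
have leS w : w \in u :: s -> S <= #|W w|.
  by move=> /leWS; apply: leq_trans; rewrite leq_pmulr //; lia.
pose N w v := W w :&: nbhd (target k a u w) v.
pose D w w' v :=
  crowded k.+1 a (target k a u w') (#|W w'| %/ x) (W w) (W w') v.
pose sp w w' := sparse_to k.+1 a x (W w) (W w').
pose n := #|I|.
(* Diagonal pairs encode a low degree of [v], off-diagonal pairs encode crowding, so one union bound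
   over [ss] covers both. *)
pose bad (p : I * I) v := if p.1 == p.2 then #|N p.1 v| * (4 * L) < #|W p.1|
  else sp p.1 p.2 && (#|W p.1| < #|D p.1 p.2 v| * (16 * L * n)).
pose ss := [seq (w, w') | w <- s, w' <- s].
have n0 : 0 < n by apply/card_gt0P; exists u.
have few p : p \in ss -> #|[set v | bad p v]| * T <= 16 * L * n * S.
  case/allpairsP => -[w w'] /= [ws w's ->].
  rewrite /bad /=; case: eqP => [_|_].
    apply: leq_trans (few_low (leS w _) (target_lt u w leL)) _.
      by rewrite inE ws orbT.
    by rewrite leq_pmull //; lia.
  case: (boolP (sp w w')) => [spw|_] /=; last first.
    by rewrite (eq_card0 (A := [set v | _])) // => v; rewrite !inE.
  apply: (card_many_crowded _ (target_lt u w' leL) _ _ _ spw).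
  - by apply: leWS; rewrite inE w's orbT.
  - by lia.
  - by apply: W0; rewrite inE ws orbT.
have [/existsP[v /andP[vW /hasPn good]]|/existsPn stuck] :=
  boolP [exists v, (v \in W u) && ~~ has (bad^~ v) ss]; last first.
  (* Without a good vertex, one of at most [n ^ 2] pairs is bad for a fraction [1 / n ^ 2] of [W u],
     which forces [T <= 16 * L * n ^ 3]. *)
  exfalso.
  have cov : {in W u, forall v, has (bad^~ v) ss}.
    by move=> v vW; have := stuck v; rewrite vW negbK.
  have uu : u \in u :: s by rewrite inE eqxx.
  have [p pss le] := pigeonhole_cover (W0 u uu) cov.
  have le1 : #|[set v in W u | bad p v]| <= #|[set v | bad p v]|.
    by apply: subset_leq_card; apply/subsetP => v; rewrite !inE => /andP[].
  have szs : size s <= n by rewrite /n cardE uniq_leq_size // => w; rewrite mem_enum.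
  have szss : size ss <= n * n by rewrite size_allpairs leq_mul.
  have le2 := leq_trans le (leq_mul szss le1).
  have := leq_mul le2 (leqnn T); rewrite -mulnA => le3.
  have le4 := leq_trans le3 (leq_mul (leqnn (n * n)) (few p pss)).
  have := leq_mul (leS u uu) (leqnn T) => le5.
  have := leq_trans le5 le4.
  have -> : n * n * (16 * L * n * S) = S * (16 * L * n ^ 3).
    by rewrite !expnS expn0; lia.
  by rewrite leq_pmul2l // leqNgt leT.
pose W' w := [set z in N w v | (z \notin blue_in k.+1 a v) &&
  all (fun w' => ((w != w') && sp w w') ==> (z \notin D w w' v)) s].
have W'N w : W' w \subset N w v by apply/subsetP => z; rewrite inE => /andP[].
(* In units of [#|W w| / L]: at least 1/4 for [N w v], less 1/16 for blue neighbours of [v] and 1/16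
   for crowded vertices, leaves 1/8. *)
have leW' w : w \in s -> #|W w| <= #|W' w| * (8 * L).
  move=> ws; have wus : w \in u :: s by rewrite inE ws orbT.
  pose Bv := W w :&: blue_in k.+1 a v.
  pose us' := [seq w' <- s | (w != w') && sp w w'].
  have cov : N w v \subset W' w :|: Bv :|:
      [set z in N w v | has (fun w' => z \in D w w' v) us'].
    apply/subsetP => z zN; move: (zN); rewrite inE => /andP[zW _].
    rewrite !in_setU; have [//|zW'] /= := boolP (z \in W' w).
    rewrite [z \in Bv]inE zW /=.
    have [//|zb] /= := boolP (z \in blue_in k.+1 a v).
    move: zW'; rewrite /W' in_set zN zb /= -has_predC => /hasP[w' w's /=].
    rewrite negb_imply negbK => /andP[cw zD].
    by rewrite inE zN; apply/hasP; exists w' => //; rewrite mem_filter cw.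
  have leN : #|W w| <= #|N w v| * (4 * L).
    have := good (w, w); rewrite /bad /= eqxx -leqNgt; apply.
    by apply/allpairsP; exists (w, w).
  have leB : #|Bv| * (16 * L) <= #|W w|.
    have /allP/(_ w ws)/sparse_toP/(_ v vW) := spu; apply: leq_trans.
    by rewrite leq_mul2l -/x xy; apply/orP; right; nia.
  have leD : #|[set z in N w v | has (fun w' => z \in D w w' v) us']| * (16 * L)
      <= #|W w|.
    set Z := [set z in N w v | _].
    have le1 : #|Z| <= \sum_(w' <- us') #|D w w' v|.
      have covZ : {in Z, forall z, has (fun w' => z \in D w w' v) us'}.
        by move=> z; rewrite inE => /andP[].
      apply: leq_trans (card_le_sum_cover covZ) _; apply: leq_sum => w' _.
      by apply: subset_leq_card; apply/subsetP => z; rewrite inE => /andP[].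
    have le2 : (\sum_(w' <- us') #|D w w' v|) * (16 * L * n) <= n * #|W w|.
      rewrite big_distrl /= big_seq.
      apply: (@leq_trans (\sum_(w' <- us' | w' \in us') #|W w|)).
        apply: leq_sum => w'; rewrite mem_filter => /andP[/andP[nw spw] w's].
        have := good (w, w'); rewrite /bad /= (negPf nw) spw -leqNgt; apply.
        by apply/allpairsP; exists (w, w').
      rewrite -big_seq big_const_seq count_predT iter_addn_0 mulnC leq_mul2r.
      apply/orP; right; rewrite (leq_trans (size_subseq (filter_subseq _ _))) //.
      by rewrite /n cardE uniq_leq_size // => w'; rewrite mem_enum.
    rewrite -(leq_pmul2l n0); apply: leq_trans le2.
    by rewrite mulnC -mulnA leq_mul.
  set Z := [set z in N w v | _] in cov leD.
  have leNZ : #|N w v| <= #|W' w| + #|Bv| + #|Z|.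
    apply: leq_trans (subset_leq_card cov) _.
    apply: leq_trans (leq_card_setU _ _) _; rewrite leq_add2r.
    exact: leq_card_setU.
  by have := leq_mul leNZ (leqnn L); lia.
have [f fW' fR] : exists2 f : I -> V, {in s, forall u, f u \in W' u} &
    {in s &, forall u w, u != w -> lab (f u) (f w) = target k a u w /\
       f w \notin blue_in k.+1 a (f u)}.
  apply: IH => // [w ws|].
    have wus : w \in u :: s by rewrite inE ws orbT.
    have L80 : 0 < 8 * L by lia.
    rewrite -(leq_pmul2r L80); apply: leq_trans (leW' w ws).
    apply: leq_trans (leW w wus); rewrite -mulnA -expnSr leq_mul2r.
    by rewrite leq_mul2l -/x -/y xy leq_pmull ?orbT.
  have spE : {in s &, subrel (fun w w' => (w != w') && sp w w')
      (fun w w' => sparse_to k.+1 a y (W' w) (W' w'))}.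
    move=> w w' ws w's /andP[nw spw]; apply/sparse_toP => z.
    rewrite inE => /and3P[/setIP[zW _] _ /allP/(_ w' w's)].
    rewrite nw spw /= inE zW /= -leqNgt.
    set F := blue_in _ _ z => leNF.
    have leW'F : #|W' w' :&: F| <= #|N w' v :&: F|.
      by apply: subset_leq_card; apply: setSI.
    have := leq_trunc_div #|W w'| x; rewrite {2}xy => leh.
    exact: density_step leW'F leNF leh (leW' w' w's) L_gt0.
  apply: (sub_in_pairwise (P := mem s) spE); first exact/allP.
  by rewrite (pairwise_relI (fun w w' => w != w')) -uniq_pairwise s_uniq.
exists (fun w => if w == u then v else f w) => [w|w1 w2]; rewrite !in_cons.
  by case: eqP => [->|_] //= /fW'; rewrite inE => /andP[/setIP[]].
have fv w : w \in s -> lab v (f w) = target k a u w /\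
    f w \notin blue_in k.+1 a v.
  by move=> /fW'; rewrite inE => /andP[/setIP[_]]; rewrite inE => /eqP-> /andP[].
case: (eqVneq w1 u) => [->|n1]; case: (eqVneq w2 u) => [->|n2] //=.
- by move=> _ /fv + _.
- by move=> /fv[labE nb] _ _; rewrite labC targetC blue_inC.
- exact: fR.
Qed.

(** If no zone holds a blue copy, [sparse_sequence] applies to the whole vertex set, and the first
    [#|I|] sets it yields host a red one. *)
Theorem zone_copy_exists (j k d d' : nat) :
  16 * L * #|I| ^ 3 < T -> 0 < #|I| <= 2 ^ j -> 2 ^ j <= k -> K ^ k < L ->
  16 * L * 16 ^ #|I| <= d' -> 2 * d' * 2 ^ j <= d ->
  S * d' * (8 * L) ^ #|I| * (2 * #|I| * d ^ #|I|) ^ j <= #|V| ->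
  exists b k' a', a' + K ^ k'.+1 < L /\ zone_copy b k' a'.
Proof.
move=> leT /andP[I0 leI] lek KL led' led leV.
have [[k1 [a1 [lt cp]]]|nocopy] :=
  pselect (exists k1 a1, a1 + K ^ k1.+1 < L /\ zone_copy true k1 a1).
  by exists true, k1, a1.
have j0 : 0 < 2 ^ j by rewrite expn_gt0.
have I16 : 0 < 16 ^ #|I| by rewrite expn_gt0.
have d'0 : 16 * L <= d' by apply: leq_trans led'; rewrite leq_pmulr.
have led4 : 4 * L <= d by nia.
have ltIT : #|I| < T.
  apply: leq_ltn_trans leT; rewrite !expnS expn0 muln1.
  by rewrite !mulnA leq_pmull // !muln_gt0 L_gt0 I0.
have L8 : 0 < (8 * L) ^ #|I| by rewrite expn_gt0 muln_gt0 L_gt0.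
have leS : S <= S * d' * (8 * L) ^ #|I|.
  by rewrite -mulnA leq_pmulr // muln_gt0 L8 andbT; lia.
have nocopy' k1 a1 : a1 + K ^ k1.+1 < L -> ~ zone_copy true k1 a1.
  by move=> lt cp; apply: nocopy; exists k1, a1.
have leV' : S * d' * (8 * L) ^ #|I| * (2 * #|I| * d ^ #|I|) ^ j <= #|[set: V]|.
  by rewrite cardsT.
have := @sparse_sequence d d' _ _ j led4 ltIT leS I0 led (leqnn _) nocopy'
  setT k 0 lek KL leV'.
move=> [[|k'] [a' [Ws [lek' [_ lea'] sWs /(all_nthP set0) aWs pWs]]]].
  (* At most [2 ^ j - 1] of the [k >= 2 ^ j] letters are consumed, so one is left to encode the
     ranks. *)
  by exfalso; lia.
have lea'L : a' + K ^ k'.+1 < L by lia.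
exists false, k', a'; split=> //.
pose W u := nth set0 Ws (index u (enum I)).
have iW u : index u (enum I) < size Ws.
  by rewrite sWs (leq_trans _ leI) // cardE index_mem mem_enum.
have V0 : 0 < #|V|.
  apply: leq_trans leV; rewrite muln_gt0 (leq_trans S_gt0) //= expn_gt0.
  by rewrite !muln_gt0 I0 /= expn_gt0; lia.
have leE : 16 * L * 16 ^ size (enum I) <= d' by rewrite -cardE.
have [||f _ fR] := @sparse_embedding k' a' (16 * L) (enum I) W leT (leqnn _)
  lea'L (enum_uniq I) V0.
- move=> u _; have /andP[_] := aWs _ (iW u); apply: leq_trans.
  by rewrite -cardE; do 2!apply: leq_mul => //.
- have WE : map W (enum I) = take #|I| Ws.
    have szt : size (take #|I| Ws) = #|I| by rewrite size_takel // sWs.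
    apply: (@eq_from_nth _ set0) => [|i]; first by rewrite size_map szt cardE.
    rewrite size_map => ilt; have /card_gt0P[u0 _] := I0.
    rewrite (nth_map u0) // nth_take ?cardE // /W index_uniq //.
    exact: enum_uniq.
  rewrite -(pairwise_map W (sparse_to k'.+1 a' _)) WE.
  have /andP[pW _] : pairwise (sparse_to k'.+1 a' d') (take #|I| Ws) && true.
    by move: pWs; rewrite -{1}(cat_take_drop #|I| Ws) pairwise_cat => /and3P[_ ->].
  apply: sub_pairwise pW => X Y /sparse_toP sp; apply/sparse_toP => z /sp.
  by apply: leq_trans; rewrite leq_mul2l leE orbT.
exists f => u w uw; have [] := fR u w; rewrite ?mem_enum //.
rewrite /target /matches inE => -> ; case: ifP => // /rk_lt rK.
(* The targeted label is the least element of the child zone, hence also lies in the parent zone,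
   where blue is excluded. *)
have K0 : 0 < K ^ k' by rewrite expn_gt0; lia.
have zk : zone k' (a' + rk u w * K ^ k') (a' + rk u w * K ^ k').
  by rewrite /zone leqnn -[X in X < _]addn0 ltn_add2l.
by rewrite zk (zone_child rK zk) /= => /negPf->.
Qed.

End LabelledArrow.

(** * A quasirandom labelling over a finite field *)

Lemma exists_balanced_map (T : finType) (q L : nat) : #|T| = q * L ->
  exists f : T -> nat, forall l, l < L -> #|[set x | f x == l]| = q.
Proof.
move=> cT; have cE : #|T| = #|{: 'I_q * 'I_L}| by rewrite card_prod !card_ord.
pose h x := enum_val (cast_ord cE (enum_rank x)).
have h_inj : injective h.
  by move=> x y /enum_val_inj/cast_ord_inj/enum_rank_inj.
have h_bij : bijective h by apply: inj_card_bij; rewrite // cE.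
exists (fun x => (h x).2 : nat) => l lL.
transitivity #|h @^-1: setX [set: 'I_q] [set Ordinal lL]|.
  by apply: eq_card => x; rewrite !inE.
rewrite on_card_preimset ?cardsX ?cardsT ?card_ord ?cards1 ?muln1 //.
by have [h' hK h'K] := h_bij; exists h' => x _.
Qed.

Section Bilinear.

Variable F : finFieldType.
Local Open Scope ring_scope.

(** Point-line incidence in symmetric form: for fixed [y], the level sets in [x] are the parallel
    lines of slope [- y.2]. *)
Definition pairing (x y : F * F) : F := x.1 + y.1 + x.2 * y.2.

Lemma pairingC x y : pairing x y = pairing y x.
Proof. by rewrite /pairing [x.1 + _]addrC [x.2 * _]mulrC. Qed.

Lemma card_pairing (P : {set F}) y :
  #|[set x | pairing x y \in P]| = (#|F| * #|P|)%N.
Proof.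
pose h (x : F * F) := (x.2, pairing x y).
have h_inj : injective h.
  move=> [a b] [a' b'] [->]; rewrite /pairing /= => /addIr/addIr->.
  by [].
have h_bij : bijective h by apply: inj_card_bij.
transitivity #|h @^-1: setX [set: F] P|.
  by apply: eq_card => x; rewrite !inE.
rewrite on_card_preimset ?cardsX ?cardsT //.
by have [h' hK h'K] := h_bij; exists h' => x _.
Qed.

(** Non-parallel lines meet in at most one point, so [x] is determined by its two values in [P]. *)
Lemma card_pairing2 (P : {set F}) y y' : y.2 != y'.2 ->
  (#|[set x | (pairing x y \in P) && (pairing x y' \in P)]| <= #|P| * #|P|)%N.
Proof.
move=> ny; pose h (x : F * F) := (pairing x y, pairing x y').
have h_inj : injective h.
  move=> [a b] [a' b'] [] /=; rewrite /pairing /= => e1 e2.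
  have /eqP : (b - b') * (y.2 - y'.2) = 0.
    have -> : (b - b') * (y.2 - y'.2) =
        ((a + y.1 + b * y.2) - (a' + y.1 + b' * y.2))
      - ((a + y'.1 + b * y'.2) - (a' + y'.1 + b' * y'.2)) by ring.
    by rewrite e1 e2 !subrr.
  rewrite mulf_eq0 !subr_eq0 (negPf ny) orbF => /eqP bb'.
  by move: e1; rewrite bb' => /addIr/addIr->.
rewrite -cardsX -(card_imset _ h_inj); apply: subset_leq_card.
by apply/subsetP => _ /imsetP[x + ->]; rewrite !inE.
Qed.

End Bilinear.

Lemma sum_card_rel (T U : finType) (Y : {set U}) (r : T -> U -> bool) :
  \sum_x #|[set y in Y | r x y]| = \sum_(y in Y) #|[set x | r x y]|.
Proof.
under eq_bigr do rewrite -sum1_card big_mkcond.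
rewrite exchange_big /= [RHS]big_mkcond /=; apply: eq_bigr => y _.
case: ifPn => yY; last by apply: big1 => x _; rewrite !inE (negPf yY).
by rewrite -big_mkcond sum1dep_card; apply: eq_card => x; rewrite !inE yY.
Qed.

Lemma sum_card_rel_sq (T : finType) (Y : {set T}) (r : rel T) :
  \sum_x #|[set y in Y | r x y]| ^ 2 =
  \sum_(y in Y) \sum_(y' in Y) #|[set x | r x y && r x y']|.
Proof.
transitivity (\sum_x #|[set p in setX Y Y | r x p.1 && r x p.2]|).
  apply: eq_bigr => x _; rewrite expnS expn1 -cardsX; apply: eq_card => p.
  by rewrite !inE andbACA.
rewrite (sum_card_rel (setX Y Y) (fun x p => r x p.1 && r x p.2)).
rewrite pair_big /=; apply: eq_bigl => p.
by rewrite !inE.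
Qed.

(* Second moment method: the sum of [(L * deg x - #|Y|) ^ 2] over all [x] is at
   most [#|Y| * L * #|F| ^ 3].  The condition on [B] is
   [#|Y| ^ 2 <= 4 * (L * deg x - #|Y|) ^ 2], expanded to avoid truncated
   subtraction. *)
Lemma card_atypical (F : finFieldType) (P : {set F}) (q L : nat)
    (Y B : {set F * F}) :
  let deg x := #|[set y in Y | pairing x y \in P]| in
  #|F| = q * L -> #|P| = q -> 
  {in B, forall x, #|Y| ^ 2 + 8 * (L * deg x * #|Y|) <=
                   4 * (L * deg x) ^ 2 + 4 * #|Y| ^ 2} ->
  #|B| * #|Y| <= 4 * L * #|F| ^ 3.
Proof.
move=> deg cF cP atyp.
have [->|Y0] := posnP #|Y|; first by rewrite muln0.
have sum1 : \sum_x deg x = #|Y| * (#|F| * q).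
  rewrite sum_card_rel -sum_nat_const; apply: eq_bigr => y _.
  by rewrite card_pairing cP.
have sum2 : \sum_x deg x ^ 2 <= #|Y| ^ 2 * q ^ 2 + #|Y| * (#|F| * (#|F| * q)).
  rewrite sum_card_rel_sq.
  rewrite [X in X + _](_ : _ = \sum_(y in Y) #|Y| * q ^ 2); last first.
    by rewrite sum_nat_const mulnA mulnn.
  rewrite -[X in _ + X]sum_nat_const -big_split /=; apply: leq_sum => y yY.
  (* Non-parallel pairs give the main term; at most [#|F|] points [y'] share the slope of [y], each
     bounded trivially by [#|F| * q]. *)
  rewrite (bigID (fun y' => y'.2 == y.2)) /= addnC leq_add //.
    rewrite -sum_nat_const big_mkcondr /=; apply: leq_sum => y' _.
    case: ifP => // ny; rewrite expnS expn1 -cP; apply: card_pairing2.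
    by rewrite eq_sym ny.
  apply: (@leq_trans (\sum_(y' in [set y' : F * F | y'.2 == y.2]) #|F| * q)).
    rewrite [leqRHS](bigID (mem Y)) /=.
    apply: leq_trans (leq_addr _ _).
    rewrite [leqRHS](eq_bigl (fun y' => (y' \in Y) && (y'.2 == y.2))) => [|y'].
      apply: leq_sum => y' _; rewrite -cP -(card_pairing P y).
      by apply: subset_leq_card; apply/subsetP => x; rewrite !inE => /andP[].
    by rewrite inE andbC.
  rewrite sum_nat_const leq_mul2r; apply/orP; right.
  have /subset_leq_card : [set y' : F * F | y'.2 == y.2] \subset
      [set (a, y.2) | a in F].
    by apply/subsetP => -[a b]; rewrite inE => /eqP/= ->; apply: imset_f.
  by move=> /leq_trans; apply; rewrite (leq_trans (leq_imset_card _ _)).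
have cV : #|{: F * F}| = #|F| ^ 2 by rewrite card_prod expnS expn1.
have sum3 : #|B| * #|Y| ^ 2 + 8 * (L * #|Y| * \sum_x deg x) <=
    4 * L ^ 2 * (\sum_x deg x ^ 2) + #|F| ^ 2 * (4 * #|Y| ^ 2).
  rewrite -sum_nat_const -[X in _ <= _ + X * _]cV -sum_nat_const !big_distrr /=.
  rewrite -big_split /= [X in X + _]big_mkcond -big_split /=.
  apply: leq_sum => x _; case: ifPn => [/atyp|_].
    by move: (deg x) #|Y| => m n; rewrite -!mulnn; lia.
  have [+ _] := nat_Cauchy (L * deg x) #|Y|.
  by move: (deg x) #|Y| => m n; rewrite -!mulnn; lia.
rewrite sum1 in sum3.
have sum4 := leq_mul (leqnn (4 * L ^ 2)) sum2.
rewrite -(leq_pmul2r Y0) cF; rewrite {}cF in sum3 sum4.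
move: sum3 sum4 {sum1 sum2}; move: (\sum_x _) => s2.
move: #|B| #|Y| => b n; rewrite !expnS !expn0 !muln1.
by lia.
Qed.

(* The diagonal gets the otherwise unused label [2 ^ l], which makes every zone
   copy injective. *)
Theorem typical_labelling (k l S T : nat) :
  0 < k -> l <= k -> 4 * 2 ^ l <= S -> 4 * 2 ^ l * (2 ^ k) ^ 3 * T <= S ^ 2 ->
  exists (V : finType) (lab : V -> V -> nat),
    [/\ #|V| = (2 ^ k) ^ 2,
        forall x y, lab x y = lab y x, forall x, lab x x = 2 ^ l,
        forall (Y : {set V}) r, S <= #|Y| -> r < 2 ^ l ->
          #|[set x | #|Y :&: nbhd lab r x| * (4 * 2 ^ l) < #|Y|]| * T <= S &
        forall (Y : {set V}) r, S <= #|Y| -> r < 2 ^ l ->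
          #|[set x | 2 * #|Y| < #|Y :&: nbhd lab r x| * 2 ^ l]| * T <= S].
Proof.
move=> k0 lek leS leT; have [F _ cF] := pPrimePowerField (isT : prime 2) k0.
pose q := 2 ^ (k - l); set L := 2 ^ l in leS leT *.
have L0 : 0 < L by rewrite expn_gt0.
have cFq : #|F| = q * L by rewrite cF -expnD subnK.
have [f cf] := exists_balanced_map cFq.
pose lab (x y : F * F) := if x == y then L else f (pairing x y).
have S0 : 0 < S by lia.
have atypT (Y B : {set F * F}) : S <= #|Y| -> #|B| * #|Y| <= 4 * L * #|F| ^ 3 ->
    #|B| * T <= S.
  move=> leY leB; rewrite -(leq_pmul2r S0) mulnn; apply: leq_trans leT.
  rewrite -cF; apply: leq_trans (leq_mul leB (leqnn T)).
  by rewrite mulnAC leq_mul2r leq_mul2l leY !orbT.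
pose deg r (Y : {set F * F}) x :=
  #|[set y in Y | pairing x y \in [set c | f c == r]]|.
(* The diagonal label removes at most [x] itself, hence the successor; [4 * L <= S] absorbs it
   below. *)
have leNd r Y x : r < L -> #|Y :&: nbhd lab r x| <= deg r Y x <=
    #|Y :&: nbhd lab r x|.+1.
  move=> rL; apply/andP; split.
    apply: subset_leq_card; apply/subsetP => y; rewrite !inE /lab.
    by have [_|//] := eqVneq x y; rewrite [L == r]gtn_eqF ?andbF.
  rewrite -add1n -(cards1 x); apply: leq_trans (leq_card_setU _ _).
  apply: subset_leq_card; apply/subsetP => y; rewrite !inE /lab.
  by rewrite [y == x]eq_sym; have [] := eqVneq x y.
exists (F * F)%type, lab; split.
- by rewrite card_prod cF mulnn.
- by move=> x y; rewrite /lab eq_sym pairingC.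
- by move=> x; rewrite /lab eqxx.
- move=> Y r leY rL; apply: (atypT Y) => //.
  apply: (card_atypical cFq (cf r rL)) => x; rewrite inE => lt.
  have /andP[le1 le2] := leNd r Y x rL; rewrite -/(deg r Y x).
  have : 2 * (L * deg r Y x) < #|Y|.
    move: (deg r Y x) lt le2 (leq_trans leS leY); clearbody L => g.
    by move: #|Y :&: _| #|Y| => c n lt le2 leL; have := leq_mul (leqnn L) le2; lia.
  by move: (L * _) #|Y| => m n lt'; rewrite -!mulnn; nia.
- move=> Y r leY rL; apply: (atypT Y) => //.
  apply: (card_atypical cFq (cf r rL)) => x; rewrite inE => lt.
  have /andP[le1 le2] := leNd r Y x rL; rewrite -/(deg r Y x).
  have : 2 * #|Y| < L * deg r Y x.
    by apply: leq_trans lt _; rewrite mulnC leq_mul2l le1 orbT.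
  by move: (L * _) #|Y| => m n lt'; rewrite -!mulnn; nia.
Qed.

(** * The edge-ordered graph of a labelling *)

Section EdgeRank.

Variable H : eograph.

(** An edge counts itself, so ranks of edges start at 1 and the bound [#|edges H| < K] must be
    strict. *)
Definition edge_rank (e : {set H}) : nat :=
  #|[set e' in edges H | edge_le H e' e]|.

Lemma edge_rankP : {in edges H &, forall e1 e2,
  edge_le H e1 e2 = (edge_rank e1 <= edge_rank e2)}.
Proof.
move=> e1 e2 h1 h2.
have sub x y : x \in edges H -> y \in edges H -> edge_le H x y ->
    [set e' in edges H | edge_le H e' x] \subset
    [set e' in edges H | edge_le H e' y].
  move=> hx hy xy; apply/subsetP => e; rewrite !inE => /andP[he ex].
  by rewrite he (edge_le_trans hx he hy ex xy).
have [/sub/subset_leq_card->//|n12] := boolP (edge_le H e1 e2).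
have := edge_le_total h1 h2; rewrite (negPf n12) /= => e21.
apply/esym/negbTE; rewrite -ltnNge; apply: proper_card; apply/properP.
split; first exact: sub.
exists e1; rewrite !inE h1 //=.
by have := edge_le_total h1 h1; rewrite orbb.
Qed.

Lemma edge_rank_le e : edge_rank e <= #|edges H|.
Proof. by apply: subset_leq_card; apply/subsetP => x; rewrite inE => /andP[]. Qed.

Lemma card_edges : #|edges H| <= 'C(#|H|, 2).
Proof.
rewrite -(card_draws H 2); apply: subset_leq_card.
by apply/subsetP => e /edges_card2 e2; rewrite inE e2.
Qed.

End EdgeRank.

Section LabelledGraph.

Variables (V : finType) (lab : V -> V -> nat) (L : nat).
Hypothesis labC : forall x y, lab x y = lab y x.

Definition edge_label (e : {set V}) : nat :=
  if [pick p : V * V | e == [set p.1; p.2]] is Some p then lab p.1 p.2 else 0.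

Lemma edge_label2 x y : edge_label [set x; y] = lab x y.
Proof.
rewrite /edge_label; case: pickP => [[a b] /= /eqP eab|/(_ (x, y))/=]; last first.
  by rewrite eqxx.
have := set21 x y; have := set22 x y; have := set21 a b; have := set22 a b.
rewrite eab -{1 2}eab !inE.
by do 4!(case/orP => /eqP ?); subst.
Qed.

(* Ties between equal labels are broken arbitrarily. *)
Definition edge_key (e : {set V}) : nat :=
  edge_label e * #|{set V}| + enum_rank e.

Lemma edge_key_lt e1 e2 :
  edge_label e1 < edge_label e2 -> edge_key e1 < edge_key e2.
Proof.
move=> lt; apply: leq_trans (leq_addr _ _).
apply: leq_trans (leq_mul lt (leqnn _)).
by rewrite /edge_key mulSn addnC ltn_add2r ltn_ord.
Qed.

Lemma edge_key_inj : injective edge_key.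
Proof.
move=> e1 e2 e12; have [lt|lt|eql] := ltngtP (edge_label e1) (edge_label e2).
- by have := edge_key_lt lt; rewrite e12 ltnn.
- by have := edge_key_lt lt; rewrite e12 ltnn.
- by move: e12; rewrite /edge_key eql => /addnI/val_inj/enum_rank_inj.
Qed.

Definition label_edges : {set {set V}} :=
  [set e | [exists x, exists y,
     [&& x != y, e == [set x; y] & lab x y != L.-1]]].

Lemma label_edges2 x y :
  x != y -> ([set x; y] \in label_edges) = (lab x y != L.-1).
Proof.
move=> nxy; rewrite inE; apply/existsP/idP => [[a /existsP[b]]|labN].
  by case/and3P => _ /eqP eab; rewrite -(edge_label2 x) eab edge_label2.
by exists x; apply/existsP; exists y; rewrite nxy eqxx.
Qed.

Definition label_le : rel {set V} := fun e1 e2 => edge_key e1 <= edge_key e2.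

Lemma label_edges_card2 : {in label_edges, forall e : {set V}, #|e| = 2}.
Proof.
move=> e; rewrite inE => /existsP[x /existsP[y /and3P[nxy /eqP-> _]]].
by rewrite cards2 nxy.
Qed.

Lemma label_le_anti : {in label_edges &, antisymmetric label_le}.
Proof. by move=> e1 e2 _ _ /anti_leq/edge_key_inj. Qed.

Lemma label_le_trans : {in label_edges & &, transitive label_le}.
Proof. by move=> e2 e1 e3 _ _ _; apply: leq_trans. Qed.

Lemma label_le_total : {in label_edges &, total label_le}.
Proof. by move=> e1 e2 _ _; apply: leq_total. Qed.

Definition label_graph : eograph :=
  EOGraph label_edges_card2 label_le_anti label_le_trans label_le_total.

Hypotheses (L_gt0 : 0 < L) (lab_diag : forall x, lab x x = L).

Variables (H : eograph) (K : nat).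
Hypothesis edges_lt : #|edges H| < K.

Definition edge_adj : rel H := fun u w => [set u; w] \in edges H.
Definition pair_rank (u w : H) : nat := edge_rank [set u; w].

(** Child zones of distinct ranks are disjoint intervals in increasing order, so edge keys follow
    the order of [H]; the label [L.-1] on non-adjacent pairs makes the copy induced. *)
Lemma zone_copy_mono (c : {set V} -> bool) (b : bool) (k a : nat) :
  a + K ^ k.+1 < L ->
  zone_copy lab (fun x y => c [set x; y]) L edge_adj pair_rank K b k a ->
  exists S : {set label_graph}, @mono_induced_copy H label_graph c S.
Proof.
move=> leL [f fm].
have zone_bd u w l : zone K k (a + pair_rank u w * K ^ k) l -> l < L.-1.
  have rK : pair_rank u w < K by apply: leq_ltn_trans (edge_rank_le _) edges_lt.
  by move=> /(zone_child rK); rewrite /zone; lia.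
have f_inj : injective f.
  move=> u w fuw; apply/eqP; apply: contraT => /fm; rewrite fuw /matches lab_diag.
  case: ifP => _; first by move=> /andP[/zone_bd]; lia.
  by rewrite gtn_eqF //; lia.
have f_edges (e : {set H}) : (f @: e \in label_edges) = (e \in edges H).
  have [e2|ne2] := eqVneq #|e| 2; last first.
    apply/idP/idP => [/label_edges_card2|/edges_card2] e2.
      by rewrite -e2 card_imset ?eqxx in ne2.
    by rewrite e2 eqxx in ne2.
  have /eqP/cards2P[u [w [uw ->]]] := e2.
  rewrite imsetU1 imset_set1 label_edges2 ?(inj_eq f_inj) //.
  have := fm u w uw; rewrite /matches -/(edge_adj u w).
  by case: ifP => _ => [/andP[/zone_bd lt _]|->//]; rewrite ltn_eqF.
have f_label (e : {set H}) : e \in edges H ->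
    zone K k (a + edge_rank e * K ^ k) (edge_label (f @: e)).
  move=> eE; have /eqP/cards2P[u [w [uw ee]]] := edges_card2 eE.
  have := fm u w uw; rewrite /matches /edge_adj -ee eE => /andP[+ _].
  by rewrite ee imsetU1 imset_set1 edge_label2.
have f_le : {in edges H &, forall e1 e2 : {set H},
    label_le (f @: e1) (f @: e2) = edge_le H e1 e2}.
  have lt (e1 e2 : {set H}) : e1 \in edges H -> e2 \in edges H ->
      edge_rank e1 < edge_rank e2 -> edge_key (f @: e1) < edge_key (f @: e2).
    move=> h1 h2 lt; apply: edge_key_lt.
    have /andP[_ l1] := f_label _ h1; have /andP[l2 _] := f_label _ h2.
    apply: leq_trans l1 (leq_trans _ l2); rewrite -addnA leq_add2l addnC -mulSn.
    by rewrite leq_mul2r lt orbT.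
  move=> e1 e2 h1 h2; rewrite edge_rankP // /label_le.
  case: (ltngtP (edge_rank e1)) => [/lt|/lt|e12].
  - by move=> /(_ h1 h2)/ltnW.
  - by move=> /(_ h2 h1); rewrite ltnNge => /negbTE.
  - suff -> : e1 = e2 by rewrite leqnn.
    by apply: (edge_le_anti h1 h2); rewrite !edge_rankP // e12 leqnn.
pose S : {set label_graph} := f @: [set: H]; exists S.
have fS u : f u \in S by apply: imset_f.
pose g u : induced S := exist _ (f u) (fS u).
have gf (e : {set H}) : val @: (g @: e) = f @: e.
  by rewrite -imset_comp; apply: eq_imset.
split.
  exists g; split.
  - apply: inj_card_bij => [u w /(congr1 val)/f_inj //|].
    by rewrite card_sig (eq_card (B := S)) // card_imset // cardsT.
  - by move=> e; rewrite inE gf f_edges.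
  - by move=> e1 e2 h1 h2; rewrite /= /induced_le !gf; apply: f_le.
exists b => e; rewrite inE => /existsP[x /existsP[y /and3P[nxy /eqP-> labN]]].
rewrite subUset !sub1set => /andP[/imsetP[u _ xu] /imsetP[w _ yw]].
have uw : u != w by apply: contraNneq nxy => uw; rewrite xu yw uw.
have := fm u w uw; rewrite /matches -xu -yw (negPf labN).
by case: ifP => // _ /andP[_ /eqP].
Qed.

End LabelledGraph.

(** * Choice of parameters *)

(** With all parameters powers of two, the conditions compare exponents. [2 ^ A] bounds the total
    shrinkage of the sets; [k] and [s] attain equality in [s + A <= 2 * k] and
    [3 * k + 2 * l + 3 * nu + 7 <= 2 * s]. *)
Lemma arrows_pow2 (H : eograph) (nu w l e' e A k s : nat) :
  2 <= #|H| <= w -> w = 2 ^ nu -> l = 2 * nu * w + 1 -> e' = 4 + l + 4 * w ->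
  e = 1 + e' + nu -> A = e' + (3 + l) * w + (1 + nu + e * w) * nu ->
  k = 2 * A + 2 * l + 3 * nu + 7 -> s = 3 * A + 4 * l + 6 * nu + 14 ->
  edge_ind_arrows H (2 ^ (2 * k)).
Proof.
move=> /andP[leH2 leH] wE lE e'E eE AE kE sE.
have H0 : 0 < #|H| by lia.
have [||||V [lab [cV labC lab_diag few_low few_high]]] :=
  @typical_labelling k l (2 ^ s) (2 ^ (l + 3 * nu + 5)).
- by clear -kE; lia.
- by clear -kE; lia.
- by rewrite -(expnD 2 2) leq_exp2l //; clear -sE; lia.
- by rewrite -(expnD 2 2) -!expnM -!expnD leq_exp2l //; clear -kE sE; lia.
pose K := 2 ^ (2 * nu).
have edges_lt : #|edges H| < K.
  apply: leq_ltn_trans (card_edges H) _; rewrite bin2.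
  apply: (@leq_trans (#|H| ^ 2)).
    by rewrite ltn_half_double -mulnn; move: #|H| H0 => n; clear; nia.
  by rewrite /K mulnC expnM -wE leq_exp2r.
have L0 : 0 < 2 ^ l by rewrite expn_gt0.
exists (label_graph lab (2 ^ l)); first by rewrite /= cV -expnM mulnC.
move=> c; pose blue x y := c [set x; y].
have blueC x y : blue x y = blue y x by rewrite /blue setUC.
have adjC u v : @edge_adj H u v = edge_adj v u by rewrite /edge_adj setUC.
have rankC u v : @pair_rank H u v = pair_rank v u by rewrite /pair_rank setUC.
have rank_lt u v : edge_adj u v -> @pair_rank H u v < K.
  by move=> _; apply: leq_ltn_trans (edge_rank_le _) edges_lt.
have powH b : 0 < b -> b ^ #|H| <= b ^ w by move=> b0; apply: leq_pexp2l.
have [] := @zone_copy_exists V lab blue (2 ^ l) (2 ^ s) (2 ^ (l + 3 * nu + 5))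
  labC blueC L0 _ few_low few_high H (@edge_adj H) (@pair_rank H) K
  adjC rankC rank_lt nu w (2 ^ e) (2 ^ e').
- by rewrite expn_gt0.
- apply: (@leq_ltn_trans (2 ^ 4 * 2 ^ l * w ^ 3)).
    by rewrite leq_mul2l leq_exp2r // leH orbT.
  by rewrite wE -expnM -!expnD ltn_exp2l //; clear; lia.
- by rewrite H0 -wE.
- by rewrite wE.
- by rewrite /K -expnM ltn_exp2l // lE addn1.
- apply: (@leq_trans (2 ^ 4 * 2 ^ l * 16 ^ w)).
    by rewrite leq_mul2l powH ?orbT.
  by rewrite -[16]/(2 ^ 4) -expnM -!expnD leq_exp2l // e'E; clear; lia.
- by rewrite -expnS -expnD leq_exp2l // eE; clear; lia.
- apply: (@leq_trans (2 ^ s * 2 ^ e' * (2 ^ 3 * 2 ^ l) ^ w *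
      (2 * w * (2 ^ e) ^ w) ^ nu)).
    apply: leq_mul; first by rewrite leq_mul2l powH ?orbT // muln_gt0 expn_gt0.
    have [->|nu0] := posnP nu; first by rewrite !expn0.
    by rewrite leq_exp2r // leq_mul ?powH ?expn_gt0 // leq_mul2l leH.
  have -> : 2 * w * (2 ^ e) ^ w = 2 ^ (1 + nu + e * w).
    by rewrite !expnD expn1 -wE expnM.
  rewrite cV -!expnD -!expnM -!expnD.
  by rewrite leq_exp2l // kE sE AE; clear; lia.
move=> b [k' [a' [lt copy]]].
exact: (zone_copy_mono labC L0 lab_diag edges_lt lt copy).
Qed.

(** The dominant term is [e * w * nu], with [e] of order [nu * w]. *)
Lemma exponent_bound nu w : 0 < nu -> 0 < w ->
  let l := 2 * nu * w + 1 in let e' := 4 + l + 4 * w in let e := 1 + e' + nu in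
  let A := e' + (3 + l) * w + (1 + nu + e * w) * nu in
  2 * A + 2 * l + 3 * nu + 7 <= 80 * nu ^ 2 * w ^ 2.
Proof. by case: nu => // n _; case: w => // w _ /=; rewrite -!mulnn; lia. Qed.

Lemma arrows_bound (H : eograph) (nu : nat) : 0 < nu -> 2 <= #|H| <= 2 ^ nu ->
  exists2 k, edge_ind_arrows H (2 ^ (2 * k)) & k <= 80 * nu ^ 2 * (2 ^ nu) ^ 2.
Proof.
move=> nu0 leH; have w0 : 0 < 2 ^ nu by rewrite expn_gt0.
have := exponent_bound nu0 w0; eexists; last by eassumption.
exact: (arrows_pow2 leH).
Qed.

(** * The bound in real numbers *)

Local Open Scope ring_scope.

Theorem theorem9 (R : realType) :
  exists2 C : R, 0 < C &
    forall (n : nat) (H : eograph), (2 <= n)%N -> #|H| = n ->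
      exists2 N : nat, is_edge_ind_ramsey H N &
        N%:R <= 2 `^ (C * n%:R ^+ 2 * (ln n%:R / ln 2) ^+ 2).
Proof.
(* [2 * k <= 160 * nu ^ 2 * w ^ 2], where [w <= 2 * n] and [nu] is at most twice the binary
   logarithm of [n]; each doubling is squared, and [160 * 4 * 4 = 2560]. *)
exists 2560 => // n H n2 cH.
pose nu := up_log 2 n; pose w := (2 ^ nu)%N.
have /andP[ltn len] : (2 ^ nu.-1 < n <= w)%N by apply: up_log_bounds.
have nu0 : (0 < nu)%N by rewrite up_log_gt0.
have w0 : (0 < w)%N by rewrite expn_gt0.
have lew : (w <= 2 * n)%N by rewrite /w -(prednK nu0) expnS leq_mul2l ltnW.
have [|k ark lek] := @arrows_bound H nu nu0; first by rewrite cH n2.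
have exN : exists N, `[<edge_ind_arrows H N>].
  by exists (2 ^ (2 * k))%N; apply/asboolP.
case: (ex_minnP exN) => N /asboolP arN minN; exists N.
  by split=> // M /asboolP/minN.
have leN : (N <= 2 ^ (2 * k))%N by apply: minN; apply/asboolP.
have ln2 : 0 < ln 2 :> R by rewrite ln_gt0 // ltr1n.
have n_gt0 : 0 < n%:R :> R by rewrite ltr0n ltnW.
have lenu : nu%:R <= 2 * (ln n%:R / ln 2) :> R.
  have le1 : 1 <= ln n%:R / ln 2 :> R.
    by rewrite ler_pdivlMr // mul1r ler_ln ?posrE // ler_nat.
  have le2 : nu.-1%:R <= ln n%:R / ln 2 :> R.
    rewrite ler_pdivlMr // mulr_natl -lnXn // ler_ln ?posrE ?exprn_gt0 //.
    by rewrite -natrX ler_nat ltnW.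
  by rewrite -(prednK nu0) -natr1; lra.
apply: (@le_trans _ _ ((2 ^ (2 * k))%:R)); first by rewrite ler_nat.
rewrite natrX -[leLHS]powR_mulrn //; apply: ler_powR; first by rewrite ler1n.
have lek' : (2 * k <= 640 * nu ^ 2 * n ^ 2)%N.
  have : (w ^ 2 <= (2 * n) ^ 2)%N by rewrite leq_exp2r.
  move=> /(leq_mul (leqnn (80 * nu ^ 2))) /(leq_trans lek).
  by rewrite expnMn; lia.
apply: (@le_trans _ _ (640 * nu%:R ^+ 2 * n%:R ^+ 2)).
  by rewrite -!natrX -!natrM ler_nat.
have : nu%:R ^+ 2 <= (2 * (ln n%:R / ln 2)) ^+ 2 :> R.
  by rewrite ler_sqr ?nnegrE ?(le_trans _ lenu) ?ler0n.
move=> /(ler_wpM2l (mulr_ge0 (ler0n _ 640) (sqr_ge0 n%:R))).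
by congr (_ <= _); rewrite ?exprMn; ring.
Qed.
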